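(* Let $X$ and $E$ be separable complete metric spaces and let $D=\{x_1,x_2,\ldots\}$ be a fixed enumeration of a dense subset of $X$. Then either $X$ coarsely embeds into $E$, or the rank $\mathsf{rk}\big(\mathcal{C}oa(D,E),<\big)$ is countable.
   Context: Let $\mathcal Z=\{\ldots,\tfrac13,\tfrac12,1,2,3,\ldots\}$ and $\mathcal N=\{\kappa\colon\mathcal Z\to[0,\infty]\mid\kappa\text{ is non-decreasing}\}$. For real $t>0$, let $t_-$ and $t_+$ be respectively the largest and smallest elements of $\mathcal Z$ with $t_-\leqslant t\leqslant t_+$. For a map $\phi\colon X\to E$ between non-empty metric spaces and $r\in\mathcal Z$ put $\kappa_\phi(r)=\inf\{d_E(\phi(x),\phi(y)): d_X(x,y)\geqslant r\}$ (with $\inf\emptyset=\infty$) and $\omega_\phi(r)=\sup\{d_E(\phi(x),\phi(y)): d_X(x,y)\leqslant r\}$. Let $$\mathcal M_{\mathrm{coarse}}=\{(\kappa,\omega)\in\mathcal N\times\mathcal N:\ \omega(r)<\infty\text{ for all }r\in\mathcal Z\text{ and }\lim_{n\to\infty}\kappa(n)=\infty\}.$$ The map $\phi$ is a coarse embedding if $(\kappa_\phi,\omega_\phi)\in\mathcal M_{\mathrm{coarse}}$. $\mathcal{C}oa(D,E)$ is the set of all quadruples $(\kappa,\omega,k,\phi)\in\mathcal N\times\mathcal N\times\mathbb N\times E^D$ such that $(\kappa,\omega)\in\mathcal M_{\mathrm{coarse}}$ and $$\kappa\big(d(x,y)_-\big)\leqslant d\big(\phi(x),\phi(y)\big)\leqslant\omega\big(d(x,y)_+\big)$$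 for all distinct $x,y\in\{x_1,\ldots,x_k\}$. The relation $<$ on it is defined by: $(\kappa,\omega,k,\phi)<(\kappa',\omega',k',\phi')$ if and only if $(\kappa,\omega)=(\kappa',\omega')$, $k=k'+1$, and $\phi$ and $\phi'$ agree on $\{x_1,\ldots,x_{k'}\}$. A binary relation $\prec$ on a set $A$ is well-founded if there is no infinite sequence $\cdots\prec a_3\prec a_2\prec a_1$ in $A$. For well-founded $\prec$, define $\rho\colon A\to\mathrm{Ord}$ by $\rho(x)=\sup\{\rho(y)+1: y\prec x\}$ and $\mathsf{rk}(A,\prec)=\sup\{\rho(x)+1: x\in A\}$. The assertion that the rank is countable includes that the relation is well-founded (so that the rank is defined). *)

(* Defs.v *)
From HB Require Import structures.
From mathcomp Require Import all_boot all_order all_algebra.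
From mathcomp Require Import all_classical all_reals all_analysis.

Set Implicit Arguments.
Unset Strict Implicit.
Unset Printing Implicit Defensive.

Import Order.TTheory GRing.Theory Num.Theory.

Local Open Scope classical_set_scope.
Local Open Scope ring_scope.

(* [succ_sup f] is the ordinal sup {f i + 1 : i}, i.e. the least ordinal
   strictly above every [f i]; every ordinal of the universe is of this form.
   Equality of ordinals is [oeq], not Leibniz equality. *)
Inductive ord : Type := succ_sup (I : Type) (f : I -> ord).

(* sup {f i + 1} <= sup {g j + 1} iff every f i lies below some g j. *)
Fixpoint ole (a b : ord) {struct a} : Prop :=
  match a, b with
  | succ_sup A f, succ_sup B g => forall i : A, exists j : B, ole (f i) (g j)
  end.

Definition olt (a b : ord) : Prop :=
  match b with succ_sup B g => exists j : B, ole a (g j) end.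

Definition oeq (a b : ord) : Prop := ole a b /\ ole b a.

Lemma ole_refl a : ole a a.
Proof. by elim: a => I f IH i; exists i; exact: IH. Qed.

Lemma ole_trans a b c : ole a b -> ole b c -> ole a c.
Proof.
elim: a b c => I f IH [J g] [K h] /= fg gh i.
have [j fgij] := fg i; have [k ghjk] := gh j.
by exists k; exact: IH fgij ghjk.
Qed.

(* The universal property defining the supremum of the f i + 1. *)
Lemma succ_supP (I : Type) (f : I -> ord) b :
  ole (succ_sup f) b <-> forall i, olt (f i) b.
Proof. by case: b. Qed.

Lemma olt_succ_sup (I : Type) (f : I -> ord) i : olt (f i) (succ_sup f).
Proof. by exists i; exact: ole_refl. Qed.

Lemma olt_ole_trans a b c : olt a b -> ole b c -> olt a c.
Proof.
case: b c => [J g] [K h] /= [j agj] /(_ j)[k gjhk].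
by exists k; exact: ole_trans gjhk.
Qed.

Lemma olt_irr a : ~ olt a a.
Proof.
elim: a => I f IH [i fi]; apply: (IH i).
by move/succ_supP : fi; exact.
Qed.

Lemma ole_total a b : (ole a b \/ olt b a) /\ (olt a b \/ ole b a).
Proof.
elim: a b => I f IHa b; elim: b => J g IHb; split.
- have [fb|/existsNP[i nfb]] := pselect (forall i, olt (f i) (succ_sup g)).
    by left.
  by right; exists i; have [_ []] := IHa i (succ_sup g).
- have [gb|/existsNP[j ngb]] := pselect (forall j, olt (g j) (succ_sup f)).
    by right.
  by left; exists j; have [[]] := IHb j.
Qed.

Lemma oltNle a b : olt a b <-> ~ ole b a.
Proof.
split=> [ab ba|nba]; first exact: (@olt_irr a) (olt_ole_trans ab ba).
by have [_ []] := ole_total a b.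
Qed.

(* An ordinal is countable if it has countably many predecessors. *)
Definition countable_ord (a : ord) : Prop :=
  exists e : nat -> ord, forall b, olt b a -> exists n, oeq b (e n).

Section rank.
Variables (A : Type) (R : A -> A -> Prop).

Definition wellfounded : Prop :=
  ~ exists a : nat -> A, forall n, R (a n.+1) (a n).

(* Acc is what the recursion defining rho needs. *)
Lemma wellfounded_Acc : wellfounded -> forall x, Acc R x.
Proof.
move=> wf x; apply: contrapT => nAx; apply: wf.
have step (y : {y | ~ Acc R y}) :
    exists z : {y | ~ Acc R y}, R (sval z) (sval y).
  case: y => y nAy; apply: contrapT => nz; apply: (nAy); constructor => z zy.
  by apply: contrapT => nAz; apply: nz; exists (exist _ z nAz).
have [s sE] := choice step.
by exists (fun n => sval (iter n s (exist _ x nAx))) => n; exact: sE.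
Qed.

Fixpoint rho_Acc (x : A) (Ax : Acc R x) {struct Ax} : ord :=
  succ_sup (fun y : {y | R y x} => rho_Acc (Acc_inv Ax (proj2_sig y))).

Definition rho (wf : wellfounded) (x : A) : ord := rho_Acc (wellfounded_Acc wf x).

Lemma rhoE wf x : rho wf x = succ_sup (fun y : {y | R y x} => rho wf (sval y)).
Proof.
rewrite /rho; case: (wellfounded_Acc wf x) => Ax /=.
by congr succ_sup; apply/funext => y; congr rho_Acc; exact: Prop_irrelevance.
Qed.

Definition rk (wf : wellfounded) : ord := succ_sup (rho wf).

Definition countable_rank : Prop := exists wf : wellfounded, countable_ord (rk wf).

End rank.

(* [completeType] is pointed, hence these spaces are non-empty. *)
#[short(type="completeMetricType")]
HB.structure Definition CompleteMetric (K : numDomainType) :=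
  {M of Complete M & Metric K M}.

Definition separable (T : topologicalType) : Prop :=
  exists2 A : set T, countable A & dense A.

Section moduli.
Variable R : realType.

Definition calZ : set R :=
  [set r | exists n : nat, r = n.+1%:R \/ r = n.+1%:R^-1].

Lemma calZ_nat n : n.+1%:R \in calZ.
Proof. by rewrite inE; exists n; left. Qed.

Definition natZ (n : nat) : calZ := exist _ n.+1%:R (calZ_nat n).

Lemma calZ_inv n : n.+1%:R^-1 \in calZ.
Proof. by rewrite inE; exists n; right. Qed.

Definition invZ (n : nat) : calZ := exist _ n.+1%:R^-1 (calZ_inv n).

(* t_- and t_+; the default value [natZ 0] is used only when t <= 0. *)
Definition floorZ (t : R) : calZ :=
  xget (natZ 0) [set r : calZ | \val r <= t /\
    forall s : calZ, \val s <= t -> \val s <= \val r].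

Definition ceilZ (t : R) : calZ :=
  xget (natZ 0) [set r : calZ | t <= \val r /\
    forall s : calZ, t <= \val s -> \val r <= \val s].

Lemma calZ_between (t : R) : 0 < t -> exists n : nat,
  n.+1%:R <= t < n.+2%:R \/ n.+2%:R^-1 <= t < n.+1%:R^-1.
Proof.
move=> t0; have [t1|t1] := leP 1 t.
  have := truncn_itv (ltW t0); have : (0 < Num.truncn t)%N.
    by rewrite truncn_gt_nat.
  by case: (Num.truncn t) => // n _ nt; exists n; left.
have u0 : 0 < t^-1 by rewrite invr_gt0.
have u1 : 1 < t^-1 by rewrite invf_gt1.
pose P n := t^-1 <= n%:R.
have exP : exists n, P n.
  by exists (Num.truncn t^-1).+1; rewrite /P ltW// truncnS_gt.
have [[|[|n]] Pn minP] := ex_minnP exP.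
- by move: Pn; rewrite /P leNgt u0.
- by move: Pn; rewrite /P leNgt u1.
exists n; right; apply/andP; split.
  by rewrite -[leRHS]invrK lef_pV2 ?posrE.
rewrite -[ltLHS]invrK ltf_pV2 ?posrE// ltNge; apply/negP => /minP.
by rewrite ltnn.
Qed.

Lemma floorZP (t : R) : 0 < t -> \val (floorZ t) <= t /\
  forall s : calZ, \val s <= t -> \val s <= \val (floorZ t).
Proof.
move=> t0; rewrite /floorZ; case: xgetP => [r _ //|noP]; exfalso.
have [n [/andP[nt tn]|/andP[nt tn]]] := calZ_between t0.
  apply: (noP (natZ n)); split=> //= -[s /= /[dup]].
  rewrite {1}inE => -[m [->|->]] _ /= st.
    by rewrite ler_nat -ltnS -(ltr_nat R); exact: le_lt_trans tn.
  by rewrite (@le_trans _ _ 1)// ?ler1n// invf_le1// ler1n.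
apply: (noP (invZ n.+1)); split=> //= -[s /= /[dup]].
rewrite {1}inE => -[m [->|->]] _ /= st.
  have := le_lt_trans st tn; rewrite ltNge => /negP[].
  by rewrite (@le_trans _ _ 1)// ?ler1n// invf_le1// ler1n.
rewrite lef_pV2 ?posrE// ler_nat -(ltr_nat R).
by rewrite -ltf_pV2 ?posrE//; exact: le_lt_trans tn.
Qed.

Lemma ceilZP (t : R) : 0 < t -> t <= \val (ceilZ t) /\
  forall s : calZ, t <= \val s -> \val (ceilZ t) <= \val s.
Proof.
move=> t0; rewrite /ceilZ; case: xgetP => [r _ //|noP]; exfalso.
have [n [/andP[nt tn]|/andP[nt tn]]] := calZ_between t0.
  have [te|nt'] := eqVneq t n.+1%:R.
    by apply: (noP (natZ n)); split; rewrite te.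
  apply: (noP (natZ n.+1)); split=> [|[s /= /[dup]]]; first exact: ltW.
  rewrite {1}inE => -[m [->|->]] _ /= st.
    by rewrite ler_nat -(ltr_nat R) (lt_le_trans _ st)// lt_neqAle eq_sym nt'.
  have : n.+1%:R < m.+1%:R^-1 :> R.
    by rewrite (lt_le_trans _ st)// lt_neqAle eq_sym nt'.
  rewrite ltNge => /negP[].
  by rewrite (@le_trans _ _ 1)// ?ler1n// invf_le1// ler1n.
have [te|nt'] := eqVneq t n.+2%:R^-1.
  by apply: (noP (invZ n.+1)); split; rewrite te.
apply: (noP (invZ n)); split=> [|[s /= /[dup]]]; first exact: ltW.
rewrite {1}inE => -[m [->|->]] _ /= st.
  by rewrite (@le_trans _ _ 1)// ?ler1n// invf_le1// ler1n.
rewrite lef_pV2 ?posrE// ler_nat -ltnS -(ltr_nat R).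
by rewrite -ltf_pV2 ?posrE// (lt_le_trans _ st)// lt_neqAle eq_sym nt'.
Qed.

Definition calN : set (calZ -> \bar R) :=
  [set kappa | (forall r, (0 <= kappa r)%E) /\
    (forall r s, \val r <= \val s -> (kappa r <= kappa s)%E)].

Definition Mcoarse : set ((calZ -> \bar R) * (calZ -> \bar R)) :=
  [set m | [/\ calN m.1, calN m.2, (forall r, (m.2 r < +oo)%E) &
    (fun n => m.1 (natZ n)) @ \oo --> +oo%E]].

End moduli.

Arguments calZ R : clear implicits.

Section coarse_embedding.
Variables (R : realType) (X E : metricType R).

Definition compression_modulus (phi : X -> E) (r : calZ R) : \bar R :=
  ereal_inf [set (mdist (phi p.1) (phi p.2))%:E
            | p in [set p : X * X | \val r <= mdist p.1 p.2]].

Definition expansion_modulus (phi : X -> E) (r : calZ R) : \bar R :=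
  ereal_sup [set (mdist (phi p.1) (phi p.2))%:E
            | p in [set p : X * X | mdist p.1 p.2 <= \val r]].

Definition coarse_embedding (phi : X -> E) : Prop :=
  Mcoarse (compression_modulus phi, expansion_modulus phi).

Definition coarsely_embeds : Prop := exists phi : X -> E, coarse_embedding phi.

(* D is the range of the enumeration x; its k first points x_1, ..., x_k are
   x 0, ..., x k.-1. *)
Definition first_points (x : nat -> X) (k : nat) : set (range x) :=
  [set u | exists2 i, (i < k)%N & \val u = x i].

Arguments first_points x k : clear implicits.

Definition Coa (x : nat -> X) :
    set ((calZ R -> \bar R) * (calZ R -> \bar R) * nat * (range x -> E)) :=
  [set q | let: (kappa, omega, k, phi) := q in
    Mcoarse (kappa, omega) /\
    forall u v, first_points x k u -> first_points x k v -> u <> v ->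
      (kappa (floorZ (mdist (\val u) (\val v)))
         <= (mdist (phi u) (phi v))%:E
         <= omega (ceilZ (mdist (\val u) (\val v))))%E].

Arguments Coa x : clear implicits.

Definition Coa_lt (x : nat -> X) (p q : Coa x) : Prop :=
  let: (kappa, omega, k, phi) := \val p in
  let: (kappa', omega', k', phi') := \val q in
  [/\ (kappa, omega) = (kappa', omega'), k = k'.+1 &
    forall u, first_points x k' u -> phi u = phi' u].

End coarse_embedding.

Arguments coarsely_embeds {R} X E.
Arguments first_points {R X} x k.
Arguments Coa {R X} E x.
Arguments Coa_lt {R X} E x p q.

(* Main.v *)
Require Import Defs.
From mathcomp Require Import all_boot all_order all_algebra.
From mathcomp Require Import all_classical all_reals all_analysis.
From mathcomp Require Import lra.

(* Up to bounded error a coarse embedding is recorded by natural numbers: bounds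
   w_j for omega(j + 1), thresholds n_j beyond which kappa exceeds j, and, for
   each i, the index e_i of a member within distance 1 of phi(x_i) in a
   countable subset of E.  Finite such records of length k, constrained on
   x_1, ..., x_k, form a tree on a countable set, and Coa maps to it strictly
   monotonically.  An infinite branch yields a coarse embedding of X; otherwise
   the tree is well-founded, has countable rank, and bounds the rank of Coa. *)

Set Implicit Arguments.
Unset Strict Implicit.
Unset Printing Implicit Defensive.

Import Order.TTheory GRing.Theory Num.Theory.

Local Open Scope classical_set_scope.

Section ranks.
Variables (A B : Type) (RA : A -> A -> Prop) (RB : B -> B -> Prop) (f : A -> B).
Hypothesis fR : forall a a', RA a a' -> RB (f a) (f a').

Lemma wellfounded_homo : wellfounded RB -> wellfounded RA.
Proof. by move=> wfB [a aR]; apply: wfB; exists (f \o a) => n; exact: fR. Qed.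

Lemma ole_rho_homo (wfA : wellfounded RA) (wfB : wellfounded RB) a :
  ole (rho wfA a) (rho wfB (f a)).
Proof.
elim: {a}(wellfounded_Acc wfA a) => a _ IH; rewrite !rhoE /= => -[a' a'a] /=.
by exists (exist _ (f a') (fR a'a)); exact: IH.
Qed.

End ranks.

(** The values of [rho] form an initial segment of the ordinals: if [b] is not already equal to
    [rho wf a], it lies below [rho wf a'] for some predecessor [a'] of [a], and induction
    applies. *)
Lemma ole_rho_eq (A : Type) (RA : A -> A -> Prop) (wf : wellfounded RA) a b :
  ole b (rho wf a) -> exists a', oeq b (rho wf a').
Proof.
elim: {a}(wellfounded_Acc wf a) => a _ IH ba.
have [ab|/oltNle] := pselect (ole (rho wf a) b); first by exists a.
by rewrite rhoE => -[[a' a'a] /= ba']; exact: IH ba'.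
Qed.

(** Each ordinal below the rank of [RA] is bounded by some [rho wfB (f a)], hence is itself a value
    of [rho wfB]; the countable type [B] enumerates these. *)
Lemma countable_rank_homo (A : Type) (B : countType) (RA : A -> A -> Prop)
    (RB : B -> B -> Prop) (f : A -> B) :
  (forall a a', RA a a' -> RB (f a) (f a')) -> wellfounded RB ->
  countable_rank RA.
Proof.
move=> fR wfB; exists (wellfounded_homo fR wfB).
exists (fun n => if unpickle n is Some t then rho wfB t
                 else succ_sup (fun i : False => match i with end)).
move=> b [a ba].
have [t bt] := ole_rho_eq (ole_trans ba (ole_rho_homo fR _ wfB a)).
by exists (pickle t); rewrite pickleK.
Qed.

(** The longer sequence is the smaller one, so that infinite descent is an infinite branch. *)
Definition tree_ext (A : Type) (T : seq A -> Prop) (s t : seq A) : Prop :=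
  T s /\ exists a, s = rcons t a.

Lemma tree_branch (A : Type) (T : seq A -> Prop) : ~ wellfounded (tree_ext T) ->
  exists b : nat -> A, forall n, exists2 m, (n <= m)%N & T (mkseq b m).
Proof.
move=> /contrapT[a aT]; have [_ [d _]] := aT 0%N.
have sizea n : size (a n) = (n + size (a 0%N))%N.
  by elim: n => // n IH; have [_ [c ->]] := aT n; rewrite size_rcons IH.
have ntha n k i : (i < size (a n))%N -> nth d (a (k + n)%N) i = nth d (a n) i.
  move=> ia; elim: k => // k IH; have [_ [c ->]] := aT (k + n)%N.
  rewrite nth_rcons sizea (leq_trans ia) ?IH// sizea -addnA.
  exact: leq_addl.
(* [a i.+1] is longer than [i], and later terms keep its entries. *)
pose b i := nth d (a i.+1) i.
exists b => n; exists (size (a n.+1)).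
  by rewrite sizea addSn -addnS leq_addr.
suff -> : mkseq b (size (a n.+1)) = a n.+1 by have [] := aT n.
apply: (@eq_from_nth _ d) => [|i]; rewrite size_mkseq// => ia.
rewrite nth_mkseq// /b.
have [le_in|/ltnW le_ni] := leqP i.+1 n.+1.
  rewrite -(subnK le_in); rewrite ntha// sizea addSn ltnS; exact: leq_addr.
by rewrite -(subnK le_ni) ntha.
Qed.

Local Open Scope ring_scope.


Lemma dense_near (R : realType) (T : metricType R) (A : set T) (y : T) :
  dense A -> exists2 z, A z & mdist y z < 1.
Proof.
move=> dA; have [||z [yz Az]] := dA (interior (ball y 1)).
- by exists y; apply: nbhsx_ballx.
- exact: open_interior.
- by exists z => //; move/interior_subset: yz; rewrite ballEmdist.
Qed.

Lemma separable_net (R : realType) (E : completeMetricType R) : separable E ->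
  exists u : nat -> E, forall y, exists n, mdist y (u n) < 1.
Proof.
move=> [A cA dA]; have /pfcard_geP[A0|/unsquash u] := cA.
  by have [z] := dense_near point dA; rewrite A0.
exists u => y; have [z Az yz] := dense_near y dA.
by have [n _ un] := 'surj_u Az; exists n; rewrite un.
Qed.

Section coarse.
Context {R : realType}.

(* The margin 2 absorbs the replacement of two values of phi by net points. *)
Definition coarse_bounds (m : (calZ R -> \bar R) * (calZ R -> \bar R))
    (wn : nat -> nat * nat) : Prop :=
  forall j, (m.2 (natZ R j) + 2%:E <= (wn j).1%:R%:E)%E /\
    ((j%:R + 2)%:E <= m.1 (natZ R (wn j).2))%E.

Lemma Mcoarse_bounds m : Mcoarse m -> exists wn, coarse_bounds m wn.
Proof.
move=> [_ [om0 _] omfin /cvgeyPge kap].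
suff bound j : exists wn : nat * nat,
    (m.2 (natZ R j) + 2%:E <= wn.1%:R%:E)%E /\
    ((j%:R + 2)%:E <= m.1 (natZ R wn.2))%E.
  by have [wn wnP] := choice bound; exists wn.
have [n _ kapn] := kap (j%:R + 2).
exists ((Num.truncn (fine (m.2 (natZ R j)) + 2)).+1, n).
split; last exact: (kapn n (leqnn n)).
have /fineK <- : m.2 (natZ R j) \is a fin_num.
  by rewrite ge0_fin_numE.
by rewrite -EFinD lee_fin ltW// truncnS_gt.
Qed.

Variables X E : metricType R.

(* The entry at position j is ((w_j, n_j), e_j). *)
Definition coarse_record (x : nat -> X) (u : nat -> E)
    (b : nat -> nat * nat * nat) (k : nat) : Prop :=
  forall i i' j, (i < k)%N -> (i' < k)%N -> (j < k)%N ->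
    (mdist (x i) (x i') <= j.+1%:R ->
       mdist (u (b i).2) (u (b i').2) <= (b j).1.1%:R) /\
    ((b j).1.2.+1%:R <= mdist (x i) (x i') ->
       j%:R <= mdist (u (b i).2) (u (b i').2)).

Lemma coarse_record_embeds (x : nat -> X) (u : nat -> E) b :
  dense (range x) -> inhabited X ->
  (forall k, coarse_record x u b k) ->
  coarsely_embeds X E.
Proof.
move=> dx [x0] bP.
have near z : exists i, mdist z (x i) < 1.
  by have [_ [i _ <-] zi] := dense_near z dx; exists i.
have [p pP] := choice near.
(* Moving both points by less than 1 changes their distance by at most 2; the indices below are
   shifted to absorb this. *)
have pd z z' : mdist (x (p z)) (x (p z')) <= mdist z z' + 2 /\
    mdist z z' <= mdist (x (p z)) (x (p z')) + 2.
  have := pP z; have := pP z'.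
  have := metric_triangle (x (p z)) z (x (p z')).
  have := metric_triangle z z' (x (p z')).
  have := metric_triangle z (x (p z)) z'.
  have := metric_triangle (x (p z)) (x (p z')) z'.
  rewrite (metric_sym (x (p z)) z) (metric_sym (x (p z')) z'); lra.
have rec i i' j : (mdist (x i) (x i') <= j.+1%:R ->
       mdist (u (b i).2) (u (b i').2) <= (b j).1.1%:R) /\
    ((b j).1.2.+1%:R <= mdist (x i) (x i') ->
       j%:R <= mdist (u (b i).2) (u (b i').2)).
  by apply: (bP (maxn i (maxn i' j)).+1); rewrite ltnS !leq_max leqnn ?orbT.
pose psi z := u (b (p z)).2.
(* The distance in the dense sequence is at most [j + 2], the bound handled by entry [j.+1]. *)
have psi_le z z' j : mdist z z' <= j%:R ->
    mdist (psi z) (psi z') <= (b j.+1).1.1%:R.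
  move=> zj; apply: (rec _ _ _).1; have [zz _] := pd z z'.
  by rewrite -addn2 natrD; lra.
have psi_ge z z' j : (b j).1.2.+3%:R <= mdist z z' ->
    j%:R <= mdist (psi z) (psi z').
  move=> zj; apply: (rec _ _ _).2; have [_ zz] := pd z z'.
  by move: zj; rewrite -addn2 natrD; lra.
exists psi; split => /=.
- split=> [r|r s rs].
    by apply: le_ereal_inf_tmp => _ [q _ <-]; rewrite lee_fin mdist_ge0.
  apply: ereal_inf_le_tmp => _ [q /= sq <-]; exists q => //=.
  exact: le_trans sq.
- split=> [r|r s rs]; last first.
    apply: ereal_sup_le => _ [q /= rq <-]; exists q => //=.
    exact: le_trans rs.
  (* The pair [(x0, x0)] keeps the supremum from being taken over the empty set. *)
  apply: le_ereal_sup_tmp; exists (mdist (psi x0) (psi x0))%:E; last first.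
    by rewrite lee_fin mdist_ge0.
  exists (x0, x0) => //=; rewrite mdistxx; case: r => r /=.
  rewrite inE => -[n [] ->]; first exact: ler0n.
  by rewrite invr_ge0 ler0n.
- move=> r; set w := (b (Num.truncn (\val r)).+2).1.1.
  apply: (@le_lt_trans _ _ w%:R%:E); last exact: ltry.
  apply: ge_ereal_sup => _ [q /= qr <-]; rewrite lee_fin; apply: psi_le.
  by rewrite (le_trans qr)// ltW// truncnS_gt.
(* [natZ n] has value [n.+1], so [n] at least the threshold plus 2 meets the hypothesis of
   [psi_ge]. *)
- apply/cvgeyPge => A; exists (b (Num.truncn A).+1).1.2.+2 => // n /= bn.
  apply: le_ereal_inf_tmp => _ [q /= nq <-]; rewrite lee_fin.
  rewrite (le_trans (ltW (truncnS_gt A)))//; apply: psi_ge.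
  by rewrite (le_trans _ nq)// ler_nat.
Qed.

Definition range_point (x : nat -> X) (i : nat) : range x :=
  exist _ (x i) (mem_set (imageT x i)).

Lemma Coa_record (x : nat -> X) (u : nat -> E) (c : E -> nat) kappa omega k phi
    (wn : nat -> nat * nat) (b : nat -> nat * nat * nat) :
  (forall y, mdist y (u (c y)) < 1) -> coarse_bounds (kappa, omega) wn ->
  Coa E x (kappa, omega, k, phi) ->
  (forall i, (i < k)%N -> b i = (wn i, c (phi (range_point x i)))) ->
  coarse_record x u b k.
Proof.
move=> cP wnP [[/= [_ kapmono] [om0 ommono] _ _] phiP] bE i i' j ik i'k jk.
rewrite !bE//=; set v := range_point x i; set v' := range_point x i'.
have fp l : (l < k)%N -> first_points x k (range_point x l) by exists l.
(* [floorZP] and [ceilZP] require a positive distance. *)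
have dgt0 : v <> v' -> 0 < mdist (x i) (x i').
  move=> vv'; rewrite mdist_gt0; apply: contra_notN vv' => /eqP xx.
  exact: val_inj.
have [/= wn_om wn_kap] := wnP j.
have omj : mdist (x i) (x i') <= j.+1%:R ->
    mdist (phi v) (phi v') + 2 <= (wn j).1%:R.
  move=> dj; rewrite -lee_fin; apply: le_trans wn_om.
  (* The enumeration may repeat points, and [Coa] constrains only distinct ones; for equal points
     the margin 2 and [0 <= omega] suffice. *)
  have [->|/eqP vv'] := eqVneq v v'.
    by rewrite mdistxx add0r leeDr//; exact: om0.
  have /andP[_ le_om] := phiP _ _ (fp i ik) (fp i' i'k) vv'.
  rewrite EFinD leeD//; apply: le_trans le_om _; apply: ommono.
  by apply: (ceilZP _).2 => //; exact: dgt0.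
have kapj : (wn j).2.+1%:R <= mdist (x i) (x i') ->
    j%:R + 2 <= mdist (phi v) (phi v').
  move=> dj; have vv' : v <> v'.
    by move=> /(congr1 val) /= xx; move: dj; rewrite xx mdistxx lern0.
  have /andP[le_kap _] := phiP _ _ (fp i ik) (fp i' i'k) vv'.
  rewrite -lee_fin; apply: le_trans le_kap; apply: le_trans wn_kap _.
  by apply: kapmono; apply: (floorZP _).2 => //; exact: dgt0.
move: (phi v) (phi v') omj kapj => y y' omj kapj.
have := cP y; have := cP y'.
have := metric_triangle y (u (c y)) y'.
have := metric_triangle (u (c y)) (u (c y')) y'.
have := metric_triangle (u (c y)) y (u (c y')).
have := metric_triangle y y' (u (c y')).
rewrite (metric_sym (u (c y)) y) (metric_sym (u (c y')) y').
by split=> [/omj|/kapj]; lra.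
Qed.

End coarse.

Theorem theorem2p3 (R : realType) (X E : completeMetricType R)
    (sepX : separable X) (sepE : separable E)
    (x : nat -> X) (denseD : dense (range x)) :
  coarsely_embeds X E \/ countable_rank (Coa_lt E x).
Proof.
have [u uP] := separable_net sepE; have [c cP] := choice uP.
(* The bounds are chosen from the pair of moduli alone, so comparable quadruples share them; outside
   [Mcoarse] the value is arbitrary. *)
have bounds m : exists wn, @Mcoarse R m -> coarse_bounds m wn.
  have [/Mcoarse_bounds[wn wnP]|nm] := pselect (Mcoarse m); first by exists wn.
  by exists (fun=> (0, 0)%N).
have {bounds}[wn wnP] := choice bounds.
pose d0 : nat * nat * nat := (0, 0, 0)%N.
pose T s := coarse_record x u (nth d0 s) (size s).
have [wfT|/tree_branch[b bT]] := pselect (wellfounded (tree_ext T)); last first.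
  left; apply: (@coarse_record_embeds _ _ _ x u b) => //.
    exact: (inhabits point).
  (* A record of length [m] restricts to every [k <= m]. *)
  move=> k; have [m km Tm] := bT k => i i' j ik i'k jk.
  have := Tm i i' j; rewrite size_mkseq !nth_mkseq ?(leq_trans _ km)//.
  exact.
right; pose code (q : Coa E x) i :=
  let: (m, _, phi) := \val q in (wn m i, c (phi (range_point x i))).
pose node (q : Coa E x) := mkseq (code q) (\val q).1.2.
apply: (countable_rank_homo (f := node)) wfT.
move=> [[[[kap om] k] phi] q] [[[[kap' om'] k'] phi'] q'].
move=> [/= [kapE omE] kE phiE].
subst kap' om' k; have qCoa := set_mem q; split.
  rewrite /T size_mkseq.
  apply: (Coa_record cP (wnP _ qCoa.1) qCoa) => i ik.
  by rewrite nth_mkseq.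
(* The larger quadruple has one point fewer; its code agrees with the other on the first [k']
   points, so the nodes differ by this one last entry. *)
exists (wn (kap, om) k', c (phi (range_point x k'))).
rewrite /node mkseqS; congr rcons; apply/eq_in_map => i /=.
rewrite mem_iota add0n => /= ik; rewrite /code /=; congr (_, c _).
by apply: phiE; exists i.
Qed.
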